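(* Let $G$ be a word-hyperbolic group. Let $H_1,\dots,H_k$ be quasiconvex subgroups of $G$ with associated (chosen) $H_i$-walls $W_i=\{U_i,V_i\}$. Suppose that for each infinite order element $g\in G$, its axis is cut by some translate $g'W_j$ of one of the chosen walls. Then $G$ acts properly and cocompactly on the cube complex dual to the wallspace on $G$ consisting of the chosen $H_i$-walls and all their $G$-translates.
   Context: The axis of an infinite order element $g$ is the quasigeodesic $n\mapsto g^n$ ($n\in\mathbb{Z}$) in $G$. A wall $\{U,V\}$ of $G$ cuts the axis if it separates its two ends: for some $n_0$, the sets $\{g^n:n>n_0\}$ and $\{g^{-n}:n>n_0\}$ lie in distinct open halfspaces of the wall. Walls and wallspaces. A wall on a nonempty set $X$ is a pair $\{U,V\}$ of subsets (closed halfspaces) with $U\cup V=X$ (overlap allowed); its open halfspaces are $U\setminus V$ and $V\setminus U$. It separates $x,y$ if they lie in distinct open halfspaces, and $x$ betwixts it if $x\in U\cap V$. A wallspace is a set with an (indexed) collection of walls such that any two points are separated by finitely many walls and each point betwixts finitely many walls. Distinct walls may have the same pair of halfspaces, except that two distinct walls may not be the same genuine partition $\{U,V\}$ with $U\cap V=\emptyset$ and $U,V\neq\emptyset$. Dual cube complex. An orientation $c(W)=(\overleftarrow{c}(W),\overrightarrow{c}(W))$ of a wall $W$ is an ordering of its two (indexed) halfspaces. A $0$-cube of $C(X)$ is a choice of orientation $c(W)$ for every wall such that (i) $\overleftarrow{c}(W)\cap\overleftarrow{c}(W')\neq\emptyset$ for all walls $W,W'$; (ii) for each $x\in X$, $x\in\overleftarrow{c}(W)$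 for all but finitely many $W$. Two $0$-cubes are joined by a $1$-cube iff they differ on exactly one wall; for $n\ge2$ an $n$-cube is added whenever its $(n-1)$-skeleton is present. A group acting on the wallspace acts on $C(X)$ by $\overleftarrow{gc}(gW)=g\overleftarrow{c}(W)$. The action is proper if $0$-cubes have finite stabilizers. $H$-walls. For a subgroup $H\le G$, an $H$-wall is a pair $\{U,V\}$ of subsets of $G$ with $G=U\cup V$; $\{hU,hV\}=\{U,V\}$ for all $h\in H$; $U\cap V$ a finite union of $H$-orbits; and the frontiers of $U$ and of $V$ finite unions of $\ddot H$-orbits, where $\ddot H\le H$ (index at most $2$) is the subgroup stabilizing both $U$ and $V$. The frontier of $S\subseteq G$ is the set of elements of $S$ adjacent, in a Cayley graph of $G$ for a finite generating set, to an element of $G\setminus S$. Given $H_i$-walls $\{U_i,V_i\}$, the associated wallspace has underlying set $G$ and walls $\{gU_i,gV_i\}_i$, $g\in G$; two such walls are equal iff they have the same index $i$ and the same pair of halfspaces. $G$ acts by left multiplication. *)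

(* Defs.v *)
From mathcomp Require Import all_boot.
From mathcomp Require Import mathcomp_extra boolp classical_sets functions cardinality.

Set Implicit Arguments.
Unset Strict Implicit.
Unset Printing Implicit Defensive.

Local Open Scope group_scope.
Local Open Scope classical_set_scope.

(** * Groups, Cayley graphs, hyperbolicity *)

Section Group.
Variable G : groupType.

Definition is_subgroup (H : set G) : Prop :=
  [/\ H 1, forall x y, H x -> H y -> H (x * y) & forall x, H x -> H x^-1].

Definition generates (S : seq G) : Prop :=
  forall H : set G, is_subgroup H -> (forall s, s \in S -> H s) -> H = setT.

Definition infinite_order (g : G) : Prop :=
  forall n : nat, (0 < n)%N -> g ^+ n <> 1.

Definition lmul (g : G) (A : set G) : set G := [set g * x | x in A].

(* Edges join x and x s for s in S, so left multiplication acts on the graph. *)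
Definition cayley_adj (S : seq G) : rel G :=
  fun x y => (x^-1 * y \in S) || (y^-1 * x \in S).

(* As in path.v, the edge path x :: p goes from x to last x p and has length
   size p. *)
Definition geodesic (S : seq G) (x : G) (p : seq G) : Prop :=
  path (cayley_adj S) x p /\
  forall q, path (cayley_adj S) x q -> last x q = last x p ->
    (size p <= size q)%N.

(* The word metric d_S satisfies d_S(x, y) <= r. *)
Definition within (S : seq G) (r : nat) (x y : G) : Prop :=
  exists q, [/\ path (cayley_adj S) x q, last x q = y & (size q <= r)%N].

(* Slim geodesic triangles with vertices x, y, z in G: the side from x to y
   lies in the d-neighbourhood of the sides from y to z and from x to z.
   Geodesics may be reversed, so this covers all three sides; restricting to
   vertices of the Cayley graph only changes the constant d. *)
Definition hyperbolic_cayley (S : seq G) : Prop :=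
  exists d : nat, forall (x y : G) (p q r : seq G),
    geodesic S x p -> last x p = y ->
    geodesic S y q -> geodesic S x r -> last y q = last x r ->
    forall v, v \in x :: p ->
    exists2 u, (u \in y :: q) || (u \in x :: r) & within S d v u.

Definition word_hyperbolic (S : seq G) : Prop :=
  generates S /\ hyperbolic_cayley S.

Definition quasiconvex (S : seq G) (H : set G) : Prop :=
  exists r : nat, forall (x : G) (p : seq G),
    H x -> H (last x p) -> geodesic S x p ->
    forall v, v \in x :: p -> exists2 h, H h & within S r v h.

(** * H-walls *)

Definition frontier (S : seq G) (A : set G) : set G :=
  [set x | A x /\ exists2 y, ~ A y & cayley_adj S x y].

Definition finite_union_of_orbits (H A : set G) : Prop :=
  exists2 F : set G, finite_set F & A = [set h * f | h in H & f in F].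

Definition side_stabilizer (H U V : set G) : set G :=
  [set h | [/\ H h, lmul h U = U & lmul h V = V]].

Definition is_Hwall (S : seq G) (H U V : set G) : Prop :=
  [/\ U `|` V = setT,
      forall h, H h -> [set lmul h U; lmul h V] = [set U; V],
      finite_union_of_orbits H (U `&` V),
      finite_union_of_orbits (side_stabilizer H U V) (frontier S U) &
      finite_union_of_orbits (side_stabilizer H U V) (frontier S V)].

End Group.

(** * Wallspaces *)

(* An indexed closed halfspace: the halfspace is the second component.  The
   tag only serves to tell apart the two halfspaces of a wall {U, V} with
   U = V as sets, so that such a wall still has two orientations. *)
Definition halfspace (X : Type) : Type := (bool * set X)%type.

(* A collection of walls, indexed by [wall]: different indices may carry the
   same pair of halfspaces. *)
Record wall_system (X : Type) := WallSystem {
  wall : Type;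
  sides : wall -> set (halfspace X)
}.

Section Wallspace.
Variables (X : Type) (D : wall_system X).

(* For distinct sides h, h' of a wall: x lies in the open halfspace of h and
   y in the one of h'. *)
Definition open_sides (h h' : halfspace X) (x y : X) : Prop :=
  (h.2 `\` h'.2) x /\ (h'.2 `\` h.2) y.

Definition separates (w : wall D) (x y : X) : Prop :=
  exists h h', sides w = [set h; h'] /\ open_sides h h' x y.

Definition betwixts (w : wall D) (x : X) : Prop :=
  forall h, sides w h -> h.2 x.

Definition no_repeated_partition : Prop :=
  forall (w w' : wall D) (A B : set X),
    A !=set0 -> B !=set0 -> A `&` B = set0 ->
    snd @` sides w = [set A; B] -> snd @` sides w' = [set A; B] -> w = w'.

Definition is_wallspace : Prop :=
  [/\ [set: X] !=set0,
      forall w : wall D, exists h h',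
        [/\ h <> h', sides w = [set h; h'] & h.2 `|` h'.2 = setT],
      forall x y, finite_set [set w | separates w x y],
      forall x, finite_set [set w | betwixts w x] &
      no_repeated_partition].

(** * The dual cube complex *)

(* c w = (left halfspace, right halfspace) *)
Definition is_zero_cube (c : wall D -> halfspace X * halfspace X) : Prop :=
  [/\ forall w, [set (c w).1; (c w).2] = sides w,
      forall w w', (c w).1.2 `&` (c w').1.2 !=set0 &
      forall x, finite_set [set w | ~ (c w).1.2 x]].

Definition zero_cube : Type := {c | is_zero_cube c}.

Definition adjacent (c c' : zero_cube) : Prop :=
  exists w, sval c w <> sval c' w /\
    forall w', w' <> w -> sval c w' = sval c' w'.

(* The inclusion of {0,1}^n as the facet x_i = b of {0,1}^(n+1). *)
Definition facet n (i : 'I_n.+1) (b : bool) (x : {ffun 'I_n -> bool}) :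
    {ffun 'I_n.+1 -> bool} :=
  [ffun j => if unlift i j is Some j' then x j' else b].

(* f parametrizes the vertices of an n-cube: for n = 1 its two ends are
   adjacent, and for n > 1 all its facets are present. *)
Fixpoint is_cube n : ({ffun 'I_n -> bool} -> zero_cube) -> Prop :=
  match n with
  | 0 => fun _ => True
  | m.+1 => fun f =>
      [/\ injective f,
          m = 0%N -> adjacent (f [ffun=> false]) (f [ffun=> true]) &
          forall i b, is_cube (fun x => f (facet i b x))]
  end.

(* The cubes of the complex, each given by its set of vertices. *)
Definition cube (Q : set zero_cube) : Prop :=
  exists n (f : {ffun 'I_n -> bool} -> zero_cube), is_cube f /\ Q = range f.

Variables (G : groupType) (act : G -> zero_cube -> zero_cube).

Definition acts_properly : Prop :=
  forall c, finite_set [set g | act g c = c].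

(* Some finite set of cubes has translates covering the complex. *)
Definition acts_cocompactly : Prop :=
  exists K : set (set zero_cube),
    [/\ finite_set K, K `<=` cube &
        forall Q, cube Q -> exists g, exists2 P, K P & Q = act g @` P].

End Wallspace.

(** * The wallspace of a finite family of H-walls *)

Section Translates.
Variables (G : groupType) (k : nat) (U V : 'I_k -> set G).

Definition lmul_half (g : G) (h : halfspace G) : halfspace G :=
  (h.1, lmul g h.2).

Definition translate_sides (i : 'I_k) (g : G) : set (halfspace G) :=
  [set (false, lmul g (U i)); (`[< U i = V i >], lmul g (V i))].

(* A wall is an index i together with the unordered pair {g U_i, g V_i}. *)
Definition translate_wall : Type :=
  {w : 'I_k * set (halfspace G) | exists g, w.2 = translate_sides w.1 g}.

Definition translates : wall_system G :=
  @WallSystem G translate_wall (fun w => (sval w).2).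

Lemma lmulA g g' (A : set G) : lmul g (lmul g' A) = lmul (g * g') A.
Proof.
rewrite /lmul image_comp; congr (_ @` _).
by apply/funext => x /=; rewrite mulgA.
Qed.

Lemma lmul1 (A : set G) : lmul 1 A = A.
Proof.
rewrite /lmul [X in X @` _](_ : _ = id) ?image_id //.
by apply/funext => x /=; rewrite mul1g.
Qed.

Lemma lmul_halfA g g' h : lmul_half g (lmul_half g' h) = lmul_half (g * g') h.
Proof. by rewrite /lmul_half /= lmulA. Qed.

Lemma lmul_half1 h : lmul_half 1 h = h.
Proof. by case: h => b A; rewrite /lmul_half /= lmul1. Qed.

Lemma translate_wall_subproof g (w : translate_wall) :
  exists g', lmul_half g @` (sval w).2 = translate_sides (sval w).1 g'.
Proof.
case: w => -[i P] [g' /= ->]; exists (g * g').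
by rewrite /translate_sides image_setU !image_set1 /lmul_half /= !lmulA.
Qed.

Definition wall_act (g : G) (w : wall translates) : wall translates :=
  exist _ ((sval w).1, lmul_half g @` (sval w).2) (translate_wall_subproof g w).

Lemma wall_actA g g' w : wall_act g (wall_act g' w) = wall_act (g * g') w.
Proof.
apply: eq_sig_hprop => [?|/=]; first exact: Prop_irrelevance.
congr pair.
by rewrite image_comp; congr (_ @` _); apply/funext => h /=; exact: lmul_halfA.
Qed.

Lemma wall_act1 w : wall_act 1 w = w.
Proof.
apply: eq_sig_hprop => [?|]; first exact: Prop_irrelevance.
case: w => -[i P] ? /=; congr pair.
by rewrite [X in X @` _](_ : _ = id) ?image_id //; apply/funext/lmul_half1.
Qed.

(* (g c)(g w) = g c(w), written with w replaced by g^-1 w *)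
Definition orient_act (g : G) (c : wall translates -> halfspace G * halfspace G)
    (w : wall translates) : halfspace G * halfspace G :=
  let o := c (wall_act g^-1 w) in (lmul_half g o.1, lmul_half g o.2).

Lemma orient_act_zero_cube g c : is_zero_cube c -> is_zero_cube (orient_act g c).
Proof.
move=> [c_or c_meet c_fin]; split => [w|w w'|x].
- rewrite /orient_act /= -!(image_set1 (lmul_half g)) -image_setU c_or /=.
  rewrite image_comp [X in X @` _](_ : _ = id) ?image_id //.
  by apply/funext => h /=; rewrite lmul_halfA mulgV lmul_half1.
- have [x [xw xw']] := c_meet (wall_act g^-1 w) (wall_act g^-1 w').
  by exists (g * x); split; exists x.
- have := finite_image (wall_act g) (c_fin (g^-1 * x)).
  apply: sub_finite_set => w /= cx; exists (wall_act g^-1 w).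
    by move=> cx'; apply: cx; exists (g^-1 * x) => //; rewrite mulgA mulgV mul1g.
  by rewrite wall_actA mulgV wall_act1.
Qed.

Definition cube_act (g : G) (c : zero_cube translates) : zero_cube translates :=
  exist _ (orient_act g (sval c)) (orient_act_zero_cube g (svalP c)).

Lemma cube_actA g g' c : cube_act g (cube_act g' c) = cube_act (g * g') c.
Proof.
apply: eq_sig_hprop => [?|/=]; first exact: Prop_irrelevance.
apply/funext => w; rewrite /orient_act /= !lmul_halfA.
by rewrite wall_actA invgM.
Qed.

Lemma cube_act1 c : cube_act 1 c = c.
Proof.
apply: eq_sig_hprop => [?|/=]; first exact: Prop_irrelevance.
apply/funext => w; rewrite /orient_act /= invg1 wall_act1 !lmul_half1.
by case: (sval c w).
Qed.

Lemma adjacent_act g c c' :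
  adjacent c c' -> adjacent (cube_act g c) (cube_act g c').
Proof.
have half_inj h h' : lmul_half g h = lmul_half g h' -> h = h'.
  by move=> /(congr1 (lmul_half g^-1)); rewrite !lmul_halfA mulVg !lmul_half1.
move=> [w [w_neq w_eq]]; exists (wall_act g w); split=> [|w' w'_neq] /=.
  rewrite /orient_act wall_actA mulVg wall_act1 => e; apply: w_neq.
  rewrite [LHS]surjective_pairing [RHS]surjective_pairing.
  by congr pair; apply: half_inj; [move: e => /(congr1 fst)|move: e => /(congr1 snd)].
rewrite /orient_act w_eq // => e; apply: w'_neq.
by rewrite -e wall_actA mulgV wall_act1.
Qed.

(* The wall w separates the two ends of the axis n |-> g^n. *)
Definition cuts_axis (w : wall translates) (g : G) : Prop :=
  exists h h', sides w = [set h; h'] /\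
    exists n0 : nat, forall n, (n0 < n)%N -> open_sides h h' (g ^+ n) (g ^- n).

End Translates.

(* Main.v *)
(** Halfspaces are uniformly quasiconvex, since a geodesic leaving one does so
through its frontier, which is close to a quasiconvex subgroup.  Pairwise
intersecting quasiconvex sets satisfy a coarse Helly property: some point is
uniformly close to all the halfspaces chosen by the vertices of a given cube.
After translation this point is 1, and then all but finitely many walls are
oriented towards 1; so up to translation there are finitely many such
0-cubes, whence cocompactness.

For properness, an infinite order element g cannot fix a 0-cube c: the
translates by powers of g of a wall cutting its axis would give infinitely
many halfspaces of c missing 1.  If the stabilizer of c is infinite, there are
long geodesics from p to kp with kc = c, all of whose vertices v are close to
the halfspaces of c.  By pigeonhole, two vertices v_i, v_j agree both on the
0-cube v^-1 c and on the Cannon cone type of p^-1 v.  Then v_j v_i^-1 fixes c,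
and it has infinite order because equal cone types make the segment from v_i
to v_j iterable into arbitrarily long geodesics. *)

Require Import Defs.
From mathcomp Require Import all_boot.
From mathcomp Require Import mathcomp_extra boolp classical_sets functions cardinality.
From mathcomp Require Import finmap zify.

Set Implicit Arguments.
Unset Strict Implicit.
Unset Printing Implicit Defensive.

Local Open Scope group_scope.
Local Open Scope classical_set_scope.

(** * Word metrics *)

Section Within.
Variables (G : groupType) (S : seq G).

Lemma cayley_adjC x y : cayley_adj S x y = cayley_adj S y x.
Proof. by rewrite /cayley_adj orbC. Qed.

Lemma cayley_adj_mul g x y : cayley_adj S (g * x) (g * y) = cayley_adj S x y.
Proof. by rewrite /cayley_adj !invgM -!mulgA !mulKg. Qed.

Lemma within_refl x : within S 0 x x.
Proof. by exists [::]. Qed.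

Lemma within_le m n x y : (m <= n)%N -> within S m x y -> within S n x y.
Proof. by move=> mn [q [qp ql qs]]; exists q; split => //; exact: leq_trans mn. Qed.

Lemma within_trans m n y x z :
  within S m x y -> within S n y z -> within S (m + n) x z.
Proof.
move=> [p [pp <- ps]] [q [qp <- qs]]; exists (p ++ q).
by split; rewrite ?cat_path ?last_cat ?pp ?size_cat ?leq_add.
Qed.

Lemma within_adj x y : cayley_adj S x y -> within S 1 x y.
Proof. by move=> xy; exists [:: y]; rewrite /= xy. Qed.

Lemma within_sym n x y : within S n x y -> within S n y x.
Proof.
move=> [q [qp <- /within_le]]; apply; elim: q x qp => [|a q IHq] x /=.
  by move=> _; exact: within_refl.
move=> /andP[xa /IHq aq]; rewrite -addn1; apply: within_trans aq _.
by apply: within_adj; rewrite cayley_adjC.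
Qed.

Lemma within_mul g n x y : within S n x y -> within S n (g * x) (g * y).
Proof.
move=> [q [qp <- /within_le]]; apply; elim: q x qp => [|a q IHq] x /=.
  by move=> _; exact: within_refl.
move=> /andP[xa /IHq aq]; rewrite -add1n; apply: within_trans aq.
by apply: within_adj; rewrite cayley_adj_mul.
Qed.

(** The elements at finite word distance from 1 form a subgroup containing [S]. *)
Lemma generates_connected : generates S -> forall x y, exists n, within S n x y.
Proof.
move=> genS x y; suff : [set z | exists n, within S n 1 z] (x^-1 * y).
  by case=> n yn; exists n; rewrite -[x]mulg1 -[y](mulVKg x); exact: within_mul.
suff -> : [set z | exists n, within S n 1 z] = setT by [].
apply: genS; last first.
  by move=> s sS; exists 1%N; apply: within_adj; rewrite /cayley_adj invg1 mul1g sS.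
split=> [|a b [m am] [n bn]|a [n an]] /=.
- by exists 0%N; exact: within_refl.
- exists (m + n)%N; apply: within_trans am _.
  by rewrite -{1}[a]mulg1; exact: within_mul.
- by exists n; rewrite -[a^-1]mulg1 -{1}(mulVg a); apply/within_mul/within_sym.
Qed.

End Within.

Section WordMetric.
Variables (G : groupType) (S : seq G).
Hypothesis genS : generates S.

Lemma within_ex x y : exists n, `[< within S n x y >].
Proof. by have [n xy] := generates_connected genS x y; exists n; apply/asboolP. Qed.

Definition dist x y : nat := ex_minn (within_ex x y).

(** Equivalently, v lies on some geodesic from x to y; with distances alone, no path has to be
    chosen. *)
Definition between x v y : Prop := (dist x v + dist v y = dist x y)%N.

Lemma withinE n x y : within S n x y <-> (dist x y <= n)%N.
Proof.
rewrite /dist; case: ex_minnP => m /asboolP xym min_m; split=> [xyn|mn].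
  by apply: min_m; apply/asboolP.
exact: within_le mn xym.
Qed.

Lemma distxx x : dist x x = 0%N.
Proof. by apply/eqP; rewrite -leqn0; apply/withinE/within_refl. Qed.

Lemma dist_triangle y x z : (dist x z <= dist x y + dist y z)%N.
Proof. by apply/withinE/(@within_trans _ _ _ _ y); apply/withinE. Qed.

Lemma distC x y : dist x y = dist y x.
Proof. by apply/eqP; rewrite eqn_leq; apply/andP; split; apply/withinE/within_sym/withinE. Qed.

Lemma dist_mul g x y : dist (g * x) (g * y) = dist x y.
Proof.
apply/eqP; rewrite eqn_leq; apply/andP; split; apply/withinE.
  exact/within_mul/withinE.
by rewrite -(mulKg g x) -(mulKg g y); apply/within_mul/withinE; rewrite !mulVKg.
Qed.

Lemma dist_adj x y : cayley_adj S x y -> (dist x y <= 1)%N.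
Proof. by move=> xy; apply/withinE/within_adj. Qed.

Lemma dist_eq0 x y : dist x y = 0%N -> x = y.
Proof.
move=> xy0; have /withinE : (dist x y <= 0)%N by rewrite xy0.
by case=> -[|? ?] [].
Qed.

Lemma geodesic_exists x y :
  exists p, [/\ geodesic S x p, last x p = y & size p = dist x y].
Proof.
have /withinE[p [pp py ps]] := leqnn (dist x y).
have dist_le q : path (cayley_adj S) x q -> last x q = y -> (dist x y <= size q)%N.
  by move=> qp qy; apply/withinE; exists q.
exists p; split=> //; last by apply/eqP; rewrite eqn_leq ps dist_le.
by split=> // q qp ql; apply: (leq_trans ps); apply: dist_le; rewrite // ql.
Qed.

Lemma geodesic_size x p : geodesic S x p -> size p = dist x (last x p).
Proof.
move=> [pp pmin]; apply/eqP; rewrite eqn_leq; apply/andP; split; last first.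
  by apply/withinE; exists p.
have [q [[qp _] ql <-]] := geodesic_exists x (last x p).
exact: pmin.
Qed.

Lemma mem_geodesic x p v : geodesic S x p -> v \in x :: p -> between x v (last x p).
Proof.
move=> gp vp; have := geodesic_size gp; rewrite /between.
case: gp => pp _; case/splitPl: vp pp => p1 p2 <-.
rewrite cat_path last_cat size_cat => /andP[pp1 pp2].
have d1 : (dist x (last x p1) <= size p1)%N by apply/withinE; exists p1.
have d2 : (dist (last x p1) (last (last x p1) p2) <= size p2)%N.
  by apply/withinE; exists p2.
have := dist_triangle (last x p1) x (last (last x p1) p2).
set u := last x p1 in pp2 d1 d2 *; set y := last u p2 in d2 *.
move: (dist x u) (dist u y) (dist x y) (size p1) (size p2) d1 d2; lia.
Qed.

Lemma between_geodesic x v y : between x v y ->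
  exists p, [/\ geodesic S x p, last x p = y & v \in x :: p].
Proof.
move=> xvy; have [p [[pp _] pl ps]] := geodesic_exists x v.
have [q [[qp _] ql qs]] := geodesic_exists v y.
have lpq : last x (p ++ q) = y by rewrite last_cat pl.
exists (p ++ q); split => //.
  split; first by rewrite cat_path pp pl.
  move=> r rp; rewrite lpq size_cat ps qs xvy => rl.
  by apply/withinE; exists r.
by rewrite -cat_cons mem_cat -pl mem_last.
Qed.

Lemma betweenC x v y : between x v y -> between y v x.
Proof. by rewrite /between ![dist _ x]distC ![dist y _]distC (distC v); lia. Qed.

Lemma between_mul g x v y : between (g * x) (g * v) (g * y) <-> between x v y.
Proof. by rewrite /between !dist_mul. Qed.

Lemma between_transl x u v y : between x v y -> between x u v -> between x u y.
Proof.
rewrite /between => xvy xuv.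
have := dist_triangle u x y; have := dist_triangle v u y; lia.
Qed.

Lemma between_transr x u v y : between x v y -> between v u y -> between x u y.
Proof. by move=> /betweenC xvy /betweenC vuy; apply/betweenC/between_transl/vuy. Qed.

Lemma between_inner x f v g y :
  between x v y -> between x f v -> between v g y -> between f v g.
Proof.
rewrite /between => xvy xfv vgy.
have := dist_triangle v f g; have := dist_triangle f x y.
have := dist_triangle g f y; lia.
Qed.

Lemma dist_step x y : (0 < dist x y)%N ->
  exists2 z, cayley_adj S x z & dist x y = (dist z y).+1.
Proof.
have [[|z p] [gp pl <-]] := geodesic_exists x y; first by [].
have ps := geodesic_size gp.
case: gp => /= /andP[xz pp] _ _; exists z => //.
have : (dist z y <= size p)%N by apply/withinE; exists p.
move: ps; rewrite pl /= => ps.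
have := dist_triangle z x y; have := dist_adj xz; lia.
Qed.

Lemma between_exists n x y : (n <= dist x y)%N ->
  exists2 v, between x v y & dist x v = n.
Proof.
elim: n => [_|n IHn ny]; first by exists x; rewrite /between ?distxx.
have [v xvy vn] := IHn (ltnW ny).
have [|z vz dz] := @dist_step v y; first by move: xvy; rewrite /between; lia.
exists z; move: xvy; rewrite /between;
  have := dist_triangle v x z; have := dist_adj vz; have := dist_triangle z x y; lia.
Qed.

Lemma geodesic_points x y : exists v : nat -> G, [/\ v 0%N = x, v (dist x y) = y &
  forall i j, (i <= j <= dist x y)%N -> dist (v i) (v j) = (j - i)%N].
Proof.
move: {2}(dist x y) (erefl (dist x y)) => n.
elim: n x => [|n IHn] x xy; rewrite xy.
  exists (fun=> x); split=> // [|i j ij]; first exact: dist_eq0.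
  by rewrite distxx; lia.
have [|z /dist_adj xz] := @dist_step x y; first by rewrite xy.
rewrite xy => -[zy]; have [v [v0 vn dv]] := IHn z (esym zy); rewrite -zy in vn dv.
exists (fun i => if i is i'.+1 then v i' else x); split=> // -[|i] [|j] // ij.
- by rewrite distxx.
- have := dist_triangle z x (v j); have := dist_triangle (v j) x y.
  have := dv 0%N j ij; have := dv j n; rewrite v0 vn => dj d0.
  by rewrite xy dj ?d0; lia.
- by rewrite dv // subSS.
Qed.

Lemma finite_ball n x : finite_set [set y | (dist x y <= n)%N].
Proof.
elim: n => [|n IHn].
  by apply: sub_finite_set (finite_set1 x) => y /=; rewrite leqn0 => /eqP/dist_eq0.
have fin_star : finite_set [set y | cayley_adj S 1 y].
  rewrite (_ : [set y | _] = [set` S] `|` (fun y => y^-1) @` [set` S]).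
    by rewrite finite_setU; split; [|apply: finite_image]; exact: finite_seq.
  apply/seteqP; split=> y; rewrite /= /cayley_adj invg1 mul1g mulg1.
    by move=> /orP[|yS]; [left|right; exists y^-1; rewrite ?invgK].
  by case=> [->//|[z /= zS <-]]; rewrite invgK zS orbT.
apply: (@sub_finite_set _ _ ([set y | (dist x y <= n)%N] `|`
    [set y * z | y in [set y | (dist x y <= n)%N] & z in [set z | cayley_adj S 1 z]])); last first.
  by rewrite finite_setU; split=> //; exact: finite_image2.
move=> y /= yn; have [yn'|yn'] := leqP (dist x y) n; first by left.
right; have [z zy dz] := @dist_step y x ltac:(rewrite distC; lia).
exists z; first by rewrite /= distC; move: dz; rewrite (distC y); lia.
exists (z^-1 * y); last by rewrite mulVKg.
by rewrite /= -(cayley_adj_mul _ z) mulg1 mulVKg cayley_adjC.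
Qed.

End WordMetric.

(** * Finite sets and pigeonhole *)

Lemma finite_nat_bounded T (A : set T) (f : T -> nat) :
  finite_set A -> exists m, forall x, A x -> (f x <= m)%N.
Proof.
move=> /(finite_image f)/finite_seqP[s fAs]; exists (\max_(i <- s) i)%N => x Ax.
have : (f @` A) (f x) by exists x.
by rewrite fAs /= => fxs; exact: (@leq_bigmax_seq _ _ xpredT id).
Qed.

Lemma finite_pigeonhole T (A : set T) : finite_set A ->
  exists n, forall f : nat -> T, (forall i, (i <= n)%N -> A (f i)) ->
    exists i j, (i < j <= n)%N /\ f i = f j.
Proof.
(* [Pchoice] lets T be taken as a choice type, so that values of f can be counted in a sequence. *)
elim/Pchoice: T => T in A *; move=> /finite_seqP[s ->]; exists (size s) => f fs.
apply: contrapT => f_neq; suff : ((size s).+1 <= size s)%N by rewrite ltnn.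
rewrite -{1}(size_iota 0 (size s).+1) -(size_map f); apply: uniq_leq_size; last first.
  by move=> _ /mapP[i + ->]; rewrite mem_iota add0n ltnS => /andP[_ /fs].
rewrite map_inj_in_uniq ?iota_uniq // => i j; rewrite !mem_iota !add0n !ltnS.
move=> /andP[_ i_le] /andP[_ j_le] fij; apply: contrapT => /eqP.
rewrite neq_ltn => /orP[ij|ji]; apply: f_neq.
  by exists i, j; rewrite ij.
by exists j, i; rewrite ji.
Qed.

Lemma finite_subsets T (A : set T) : finite_set A -> finite_set [set B | B `<=` A].
Proof.
elim/Pchoice: T => T in A *; move=> /finite_fsetP[X ->].
apply: (@sub_finite_set _ _ ((fun Y : {fset T} => [set` Y]) @` [set` fpowerset X])).
  move=> B /= BX; have /finite_fsetP[Y BY] := finite_subfset X BX.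
  exists Y; rewrite // /= fpowersetE; apply/fsubsetP => y yY.
  by apply: BX; rewrite BY.
exact/finite_image/finite_fset.
Qed.

Lemma finite_inj T U (A : set T) (B : set U) (f : T -> U) : finite_set B ->
  (forall x, A x -> B (f x)) ->
  (forall x y, A x -> A y -> f x = f y -> x = y) -> finite_set A.
Proof.
move=> Bfin AB f_inj; rewrite -(eq_finite_set (@inj_card_eq _ _ A f _)).
  by apply: sub_finite_set Bfin => _ [x /AB Bx <-].
by move=> x y /set_mem Ax /set_mem Ay; exact: f_inj.
Qed.

(** * Slim triangles and quasiconvex sets *)

Section Hyperbolic.
Variables (G : groupType) (S : seq G) (genS : generates S).
Local Notation dist := (dist genS).
Local Notation between := (between genS).

(** Slim triangles without chosen sides: v is on any geodesic from x to y, and u on some geodesic of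
    another side. *)
Definition slim d := forall x y z v, between x v y ->
  exists2 u, (dist v u <= d)%N & between y u z \/ between x u z.

Lemma hyperbolic_slim : hyperbolic_cayley S -> exists d, slim d.
Proof.
move=> [d slimd]; exists d => x y z v /between_geodesic[p [gp lp vp]].
have [q [gq lq _]] := geodesic_exists genS y z.
have [r [gr lr _]] := geodesic_exists genS x z.
have [u ur vu] := slimd x y p q r gp lp gq gr (etrans lq (esym lr)) v vp.
exists u; first exact/withinE.
case/orP: ur => ur; [left; rewrite -lq|right; rewrite -lr]; exact: mem_geodesic.
Qed.

Definition near n (A : set G) x := exists2 a, A a & (dist x a <= n)%N.

Definition qconvex r (A : set G) :=
  forall x y v, A x -> A y -> between x v y -> near r A v.

Lemma nearT m n A x y : (dist x y <= m)%N -> near n A y -> near (m + n) A x.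
Proof. by move=> xy [a Aa ya]; exists a => //; have := dist_triangle genS y x a; lia. Qed.

Lemma near_le m n A x : (m <= n)%N -> near m A x -> near n A x.
Proof. by move=> mn [a Aa xa]; exists a => //; exact: leq_trans mn. Qed.

Lemma near_mul n g A x : near n A x -> near n (lmul g A) (g * x).
Proof. by move=> [a Aa xa]; exists (g * a); [exists a|rewrite dist_mul]. Qed.

Lemma qconvex_mul r g A : qconvex r A -> qconvex r (lmul g A).
Proof.
move=> qA _ _ v [x Ax <-] [y Ay <-] xvy; rewrite -(mulVKg g v); apply: near_mul.
by apply: (qA x y) => //; apply/(between_mul genS g); rewrite mulVKg.
Qed.

Lemma qconvex_le m n A : (m <= n)%N -> qconvex m A -> qconvex n A.
Proof. by move=> mn qA x y v Ax Ay /(qA _ _ _ Ax Ay)/(near_le mn). Qed.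

Lemma quasiconvexP H : quasiconvex S H -> exists r, qconvex r H.
Proof.
move=> [r qH]; exists r => x y v Hx Hy /between_geodesic[p [gp lp vp]].
have [|h Hh /withinE vh] := qH x p Hx _ gp v vp; first by rewrite lp.
by exists h.
Qed.

(** Serves to pass from H to [side_stabilizer], which is coarsely dense in H. *)
Lemma qconvex_dense r t A B : (forall b, B b -> A b) ->
  (forall a, A a -> near t B a) -> qconvex r A -> qconvex (r + t) B.
Proof.
move=> BA AB qA x y v /BA Ax /BA Ay /(qA _ _ _ Ax Ay)[a /AB Ba va].
exact: nearT Ba.
Qed.

(** Follow a geodesic from x towards v up to its first step out of A. *)
Lemma frontier_between (A : set G) x v : A x -> ~ A v ->
  exists2 f, frontier S A f & between x f v.
Proof.
move=> + Av; move: {2}(dist x v) (erefl (dist x v)) => n.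
elim: n x => [|n IHn] x xv Ax; first by rewrite (dist_eq0 xv) in Ax.
have [|y xy dy] := @dist_step _ _ genS x v; first by rewrite xv.
have [Ay|Ay] := pselect (A y); last first.
  by exists x; [split=> //; exists y|rewrite /between distxx].
have [|f Af yfv] := IHn y _ Ay; first lia.
exists f => //; apply: between_transr yfv; rewrite /between dy.
have := dist_adj genS xy; have := dist_triangle genS y x v; lia.
Qed.

(** * Quasiconvex sets under slim triangles, up to a coarse Helly property *)

Section Slim.
Variable d : nat.
Hypothesis slimd : slim d.

(** The diagonal from x to y' cuts the quadrilateral into two slim triangles; a point close to a
    side of length at most n is close to its end y' or x'. *)
Lemma slim_quadrilateral n x x' y y' v :
  (dist x x' <= n)%N -> (dist y y' <= n)%N -> between x v y ->
  exists2 u, between x' u y' & (dist v u <= d + d + n)%N.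
Proof.
move=> xx' yy' xvy; have [u vu [yuy'|xuy']] := slimd y' xvy.
  exists y'; first by rewrite /between distxx addn0.
  by move: yuy'; rewrite /between; have := dist_triangle genS u v y'; lia.
have [w uw [xwx'|xwy']] := slimd x' (betweenC xuy').
  exists x'; first by rewrite /between distxx.
  move: xwx'; rewrite /between; have := dist_triangle genS u v x'.
  have := dist_triangle genS w u x'; lia.
by exists w; [exact: betweenC|have := dist_triangle genS u v w; lia].
Qed.

Lemma qconvex_near n r A x y v : qconvex r A ->
  near n A x -> near n A y -> between x v y -> near (d + d + n + r) A v.
Proof.
move=> qA [a Aa xa] [b Ab yb] /(slim_quadrilateral xa yb)[u aub vu].
exact: nearT (qA _ _ _ Aa Ab aub).
Qed.

(* A geodesic leaving A does so through two frontier points, hence close to L,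
   and L is close to the frontier. *)
Lemma qconvex_frontier m r (L F A : set G) : qconvex r L ->
  frontier S A = [set h * f | h in L & f in F] ->
  (forall f, F f -> (dist 1 f <= m)%N) -> qconvex (d + d + m + r + m) A.
Proof.
move=> qL frA Fm x y v Ax Ay xvy.
have [Av|Av] := pselect (A v); first by exists v; rewrite ?distxx.
have [f frf xfv] := frontier_between Ax Av.
have [g frg ygv] := frontier_between Ay Av.
have fvg := between_inner xvy xfv (betweenC ygv).
have near_L e : frontier S A e -> near m L e.
  rewrite frA => -[h Lh [k Fk <-]]; exists h => //.
  by rewrite -{2}[h]mulg1 dist_mul distC Fm.
have [l Ll vl] := qconvex_near qL (near_L _ frf) (near_L _ frg) fvg.
(* Here k only shows that F is inhabited: l in L is then within m of the frontier point l * k of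
   A. *)
apply: nearT vl _; move: frf; rewrite frA => -[h Lh [k Fk _]].
exists (l * k); last by rewrite -{1}[l]mulg1 dist_mul Fm.
suff: frontier S A (l * k) by case.
by rewrite frA; exists l => //; exists k.
Qed.

(** Let v be at distance d + r + 1 from p on a geodesic to x0. If v were d-close to a geodesic from
    p to a, it would be within d + r of A, giving a point of A closer to x0 than p. So v is d-close
    to a geodesic from x0 to a. *)
Lemma near_nearest_point r A x0 p a : qconvex r A -> A p -> A a ->
  (forall a', A a' -> (dist x0 p <= dist x0 a')%N) ->
  exists2 u, between x0 u a & (dist p u <= d + d + r + 1)%N.
Proof.
move=> qA Ap Aa p_min; have [p_close|p_far] := leqP (dist x0 p) (d + r + 1).
  by exists x0; rewrite /between ?distxx // distC; lia.
have [|v pv dv] := @between_exists _ _ genS (d + r + 1) p x0.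
  by rewrite distC; lia.
have [u vu [x0ua|pua]] := slimd a pv.
  by exists u => //; have := dist_triangle genS v p u; lia.
have [a' Aa' ua'] := qA _ _ _ Ap Aa pua.
move: pv (p_min _ Aa'); rewrite /between !(distC genS _ x0).
have := dist_triangle genS v x0 a'; have := dist_triangle genS u v a'.
lia.
Qed.

(** A geodesic from x0 to a passes within 2d + r + 1 of p. Unless that point is already close to b,
    two slim triangles carry it, at a cost of 2d, to a geodesic from b to q, which stays near B, or
    from x0 to q. *)
Lemma coarse_helly_pair r A B x0 p q a b : qconvex r A -> qconvex r B ->
  A p -> (forall a', A a' -> (dist x0 p <= dist x0 a')%N) ->
  B q -> (dist x0 q <= dist x0 p)%N -> A a -> B b -> (dist a b <= 1)%N ->
  near (8 * d + 2 * r + 2) B p.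
Proof.
move=> qA qB Ap p_min Bq qp Aa Bb ab.
have [u x0ua pu] := near_nearest_point qA Ap Aa p_min.
have [u2 uu2 [au2b|x0u2b]] := slimd b x0ua.
  exists b => //; move: au2b; rewrite /between.
  have := dist_triangle genS u p b; have := dist_triangle genS u2 u b; lia.
have [u3 u2u3 [x0u3q|bu3q]] := slimd q (betweenC x0u2b).
  (* u3 is within 4d + r + 1 of p. Since q is no farther from x0 than p, it is no farther from u3
     than p is; doubling gives the constant. *)
  exists q => //; move: x0u3q; rewrite /between.
  have := dist_triangle genS u p u2; have := dist_triangle genS u2 p u3.
  have := dist_triangle genS u3 p q; have := dist_triangle genS u3 x0 p.
  rewrite (distC genS u3 p); lia.
have [c Bc u3c] := qB _ _ _ Bb Bq bu3q; exists c => //.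
have := dist_triangle genS u p u2; have := dist_triangle genS u2 p u3.
have := dist_triangle genS u3 p c; lia.
Qed.

(* The point realizes the distance from x0 to the member of F farthest from x0. *)
Lemma coarse_helly r N x0 (F : set (set G)) :
  (forall A, F A -> qconvex r A) ->
  (forall A, F A -> near N A x0) ->
  (forall A B, F A -> F B -> exists2 a, A a & near 1 B a) ->
  exists p, forall A, F A -> near (8 * d + 2 * r + 2) A p.
Proof.
move=> qF nearF meetF.
have exP : exists n, `[< forall A, F A -> near n A x0 >].
  by exists N; apply/asboolP.
(* The least radius [M.+1] at which x0 is near all members is attained by some A; radius 0 puts x0
   in every member. *)
case: (ex_minnP exP) => -[|M] /asboolP near_x0 M_min.
  by exists x0 => A /near_x0; exact: near_le.
have [A [FA farA]] : exists A, F A /\ ~ near M A x0.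
  apply/not_existsP => nA; have /M_min : `[< forall A, F A -> near M A x0 >].
    by apply/asboolP => A FA; apply: contrapT => AM; exact: (nA A).
  by rewrite ltnn.
have far a : A a -> (M < dist x0 a)%N.
  by move=> Aa; rewrite ltnNge; apply/negP => aM; apply: farA; exists a.
have [p Ap pM] := near_x0 _ FA; exists p => B FB.
have [q Bq qM] := near_x0 _ FB; have [a Aa [b Bb ab]] := meetF _ _ FA FB.
apply: (coarse_helly_pair (qF _ FA) (qF _ FB) Ap _ Bq _ Aa Bb ab).
  by move=> a' /far; exact: leq_trans.
exact: leq_trans qM (far _ Ap).
Qed.

(** * Cone types and iterated geodesics *)

Definition cone_type n g : set G :=
  [set h | (dist 1 h <= n)%N /\ (dist 1 (g * h) < dist 1 g)%N].

(** Induction along a geodesic from 1 to h. If the last step failed for g', some u shorter than g'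
    would be within 2d + 2 of g' and within the length of h of g' h. Types being equal, g g'^-1 u
    would be shorter than g and as close to g h, so g could not lie between 1 and g h. *)
Lemma cone_type_cone g g' h :
  cone_type (d + d + 2) g = cone_type (d + d + 2) g' ->
  between 1 g (g * h) -> between 1 g' (g' * h).
Proof.
move=> gg'; move: {2}(dist 1 h) (erefl (dist 1 h)) => n.
have dist_r x y : dist x (x * y) = dist 1 y by rewrite -{1}[x]mulg1 dist_mul.
elim: n h => [|n IHn] h hn; rewrite /between !dist_r hn => gh.
  by rewrite -(dist_eq0 hn) mulg1 addn0.
have [|h1] := @dist_step _ _ genS h 1; first by rewrite distC hn.
rewrite cayley_adjC => /(dist_adj genS) h1h.
rewrite [dist h 1]distC [dist h1 1]distC hn => -[h1n].
have := dist_triangle genS (g * h1) 1 (g * h); rewrite dist_mul => t1.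
have := dist_triangle genS g 1 (g * h1); rewrite dist_r => t2.
have : between 1 g (g * h1) by rewrite /between dist_r; lia.
move=> /(IHn _ (esym h1n)) bg'h1; apply: contrapT => g'h.
have := dist_triangle genS g' 1 (g' * h); rewrite dist_r hn => t3.
have [g'0|g'_gt0] := posnP (dist 1 g').
  by apply: g'h; rewrite -(dist_eq0 g'0) mul1g distxx hn.
have g'h1 := bg'h1; rewrite /between dist_r in g'h1.
have := dist_triangle genS (g' * h) 1 (g' * h1); rewrite dist_mul [dist h h1]distC => t4.
suff [u [u1 uh ug']] : exists u, [/\ (dist 1 u).+1 = dist 1 g',
    (dist u (g' * h)%g <= n.+1)%N & (dist u g' <= d + d + 2)%N].
  have : cone_type (d + d + 2) g' (g'^-1 * u).
    by split; [rewrite -(dist_mul genS g' 1) mulg1|]; rewrite mulVKg ?[dist g' u]distC; lia.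
  rewrite -gg' => -[_ gu].
  have := dist_triangle genS (g * (g'^-1 * u)) 1 (g * h).
  by rewrite dist_mul -(dist_mul genS g' _ h) mulVKg; lia.
(* In both cases u is at distance [(dist 1 g').-1] from 1 on a geodesic to g' h. In the first, h has
   length at most d + 1, so u is close to g' by way of g' h; in the second, the geodesic passes
   through w. *)
have [w g'w [h1wh|wh]] := slimd (g' * h) bg'h1.
  have [|u uh un] := @between_exists _ _ genS (dist 1 g').-1 1 (g' * h); first lia.
  exists u; move: uh h1wh; rewrite /between dist_mul.
  have := dist_triangle genS (g' * h) u g'; rewrite [dist (g' * h) g']distC dist_r hn.
  have := dist_triangle genS w g' (g' * h); rewrite dist_r hn.
  by split; lia.
have := dist_triangle genS w 1 g'; have := dist_triangle genS g' 1 w.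
rewrite [dist w g']distC => t5 t6.
have [w_far|w_close] := leqP (dist 1 g').-1 (dist 1 w).
  have [u uw un] := between_exists w_far; have uh := between_transl wh uw.
  have := dist_triangle genS w u g'; rewrite [dist w g']distC => t7.
  by exists u; move: uw wh uh; rewrite /between; split; lia.
have [|u uh un] := @between_exists _ _ genS ((dist 1 g').-1 - dist 1 w) w (g' * h).
  by move: wh; rewrite /between; lia.
have uh1 := between_transr wh uh; have := dist_triangle genS w u g'.
rewrite [dist w g']distC [dist u w]distC => t7.
by exists u; move: uh uh1 wh; rewrite /between; split; lia.
Qed.

(** If g lies between 1 and g u^n, equal types put g u between 1 and g u u^n. So the length of g u^n
    grows by that of u at each step, which forces the same for u^n. *)
Lemma cone_type_iter g u n :
  cone_type (d + d + 2) g = cone_type (d + d + 2) (g * u) ->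
  between 1 g (g * u) -> dist 1 (u ^+ n) = (n * dist 1 u)%N.
Proof.
have dist_r x y : dist x (x * y) = dist 1 y by rewrite -{1}[x]mulg1 dist_mul.
move=> ggu; rewrite /between dist_r => gu.
suff [] : between 1 g (g * u ^+ n) /\ dist 1 (u ^+ n) = (n * dist 1 u)%N by [].
elim: n => [|n [/(cone_type_cone ggu) + IHn]].
  by rewrite /between expg0 mulg1 !distxx addn0.
have gu_un : g * u * u ^+ n = g * u ^+ n.+1 by rewrite -mulgA expgS.
rewrite /between !dist_r gu_un IHn mulSn => gun.
have un : dist u (u ^+ n.+1) = (n * dist 1 u)%N by rewrite expgS dist_r.
have := dist_triangle genS g 1 (g * u ^+ n.+1); rewrite (dist_r g).
have := dist_triangle genS u 1 (u ^+ n.+1); rewrite un; move: gun.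
by move: (u ^+ n.+1) (n * _)%N => v m; split; lia.
Qed.

End Slim.
End Hyperbolic.

(** * Zero-cubes and cubes *)

Lemma set2_eq T (a b x y : T) : [set a; b] = [set x; y] ->
  (a = x /\ b = y) \/ (a = y /\ b = x).
Proof.
move=> e.
have : [set x; y] a by rewrite -e; left.
have : [set x; y] b by rewrite -e; right.
have : [set a; b] x by rewrite e; left.
have : [set a; b] y by rewrite e; right.
by move=> [?|?] [?|?] [?|?] [?|?]; subst; do ?[by left | by right].
Qed.

Section Cubes.
Variables (X : Type) (D : wall_system X).
Hypothesis sidesD : forall w : wall D, exists h h', h <> h' /\ sides w = [set h; h'].
Implicit Types c : zero_cube D.

Lemma zero_cube_eq c c' : (forall w, sval c w = sval c' w) -> c = c'.
Proof.
by move=> cc'; apply: eq_sig_hprop => [?|]; [exact: Prop_irrelevance|exact/funext].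
Qed.

(** The two sides of a wall are distinct, so the left one determines the right one. *)
Lemma orientation_eq c c' w : (sval c w).1 = (sval c' w).1 -> sval c w = sval c' w.
Proof.
move=> cc'; have [[cw _ _] [c'w _ _]] := (svalP c, svalP c').
have [h [h' [hh' shh']]] := sidesD w; move: (cw w) (c'w w) cc'; rewrite shh'.
case: (sval c w) (sval c' w) => [a b] [a' b'] /= abh a'b'h aa'.
by subst a'; case: (set2_eq abh) (set2_eq a'b'h) => -[? ->] [] [? ->] //; case: hh'; subst.
Qed.

Lemma orientation_sides c c' w : sval c w <> sval c' w ->
  sides w = [set (sval c w).1; (sval c' w).1].
Proof.
move=> cc'; have [[cw _ _] [c'w _ _]] := (svalP c, svalP c').
case: (set2_eq (etrans (cw w) (esym (c'w w)))) => [[e _]|[_ e]].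
  by case: cc'; exact: orientation_eq.
by rewrite -(cw w) -e.
Qed.

Lemma orientation_two c c' c'' w :
  sval c' w <> sval c w -> sval c'' w <> sval c w -> sval c' w = sval c'' w.
Proof.
move=> cc' cc''; apply: orientation_eq; have := orientation_sides cc'.
by rewrite (orientation_sides cc'') => e; case: (set2_eq e) => [[]|[-> ->]].
Qed.

Lemma adjacentC c c' : adjacent c c' -> adjacent c' c.
Proof.
move=> [w [w_neq w_eq]]; exists w; split; first exact: nesym.
by move=> w' /w_eq.
Qed.

(** * Edges and vertices of cubes *)

Definition flip n (i : 'I_n) (x : {ffun 'I_n -> bool}) : {ffun 'I_n -> bool} :=
  [ffun j => if j == i then ~~ x j else x j].

Lemma flipE n (i : 'I_n) x j : flip i x j = (if j == i then ~~ x j else x j).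
Proof. by rewrite ffunE. Qed.

Lemma facet_lift n (i : 'I_n.+1) (x : {ffun 'I_n.+1 -> bool}) :
  facet i (x i) [ffun j => x (lift i j)] = x.
Proof. by apply/ffunP => j; rewrite ffunE; case: unliftP => [j' ->|->]; rewrite ?ffunE. Qed.

(** [is_cube] mentions adjacency only in dimension 1; in higher dimension an edge in direction i
    lies in a facet that fixes another coordinate k. *)
Lemma cube_edge n (f : {ffun 'I_n -> bool} -> zero_cube D) :
  is_cube f -> forall x i, adjacent (f x) (f (flip i x)).
Proof.
elim: n f => [|n IHn] f; first by move=> _ x [].
move=> [f_inj f_edge f_facet] x i.
case: n => [|n] in f f_inj f_edge f_facet IHn x i *.
  have ffun1 (y : {ffun 'I_1 -> bool}) : y = [ffun=> y ord0].
    by apply/ffunP => j; rewrite ffunE ord1.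
  rewrite [flip i x]ffun1 {1}[x]ffun1 ffunE !ord1 eqxx.
  by case: (x ord0); [apply: adjacentC|]; exact: f_edge.
have [k ki] : exists k, k != i by exists (lift i ord0); rewrite eq_sym neq_lift.
have [i' def_i _] := unlift_some ki.
rewrite -(facet_lift k x); set x' := [ffun j => x _].
have -> : flip i (facet k (x k) x') = facet k (x k) (flip i' x').
  apply/ffunP => j; rewrite !ffunE; case: unliftP => [j' ->|->].
    by rewrite {1}def_i (inj_eq lift_inj) [in RHS]ffunE.
  by rewrite (negPf ki).
exact: (IHn (fun y => f (facet k (x k) y))).
Qed.

(** Makes halfspaces chosen at different vertices meet, as both are chosen at z. If x and y share a
    coordinate, both lie in a facet. Otherwise a flip of x that leaves w alone creates a coordinate
    shared with y. *)
Lemma cube_mix n (f : {ffun 'I_n -> bool} -> zero_cube D) : is_cube f ->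
  forall x y w w', w <> w' ->
  exists z, sval (f z) w = sval (f x) w /\ sval (f z) w' = sval (f y) w'.
Proof.
elim: n f => [|n IHn] f cf x y w w' ww'.
  by exists x; split=> //; congr (sval (f _) _); apply/ffunP => -[].
have same (u v : {ffun 'I_n.+1 -> bool}) i : u i = v i ->
    exists z, sval (f z) w = sval (f u) w /\ sval (f z) w' = sval (f v) w'.
  move=> uv; case: cf => _ _ f_facet.
  have [z [zw zw']] := IHn _ (f_facet i (u i)) [ffun j => u (lift i j)]
    [ffun j => v (lift i j)] _ _ ww'.
  exists (facet i (u i) z); rewrite {}zw {}zw' facet_lift.
  by rewrite [X in facet _ X _]uv facet_lift.
have [[i xy]|xy] := pselect (exists i, x i = y i); first exact: same xy.
have edge := cube_edge cf.
have flip_w i : sval (f (flip i x)) w = sval (f x) w ->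
    exists z, sval (f z) w = sval (f x) w /\ sval (f z) w' = sval (f y) w'.
  move=> <-; apply: (same _ _ i); rewrite flipE eqxx.
  have : x i <> y i by move=> e; apply: xy; exists i.
  by case: (x i) (y i) => -[].
have [/flip_w //|w0] := pselect (sval (f (flip ord0 x)) w = sval (f x) w).
have w_edge i : sval (f (flip i x)) w <> sval (f x) w ->
    forall v, v <> w -> sval (f (flip i x)) v = sval (f x) v.
  move=> iw v vw; have [u [_ u_eq]] := edge x i.
  have [wu|/u_eq] := pselect (w = u); last by move=> /esym/iw.
  by apply/esym/u_eq; rewrite -wu.
(* In dimension 1, y is the flip of x, and that edge changes only w, so x itself serves. *)
case: n => [|n] in f cf x y same xy edge flip_w w0 w_edge IHn *.
  exists x; split=> //; rewrite -(w_edge _ w0 _ (nesym ww')).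
  congr (sval (f _) _); apply/ffunP => i; rewrite flipE ord1 eqxx.
  have : x ord0 <> y ord0 by move=> e; apply: xy; exists ord0.
  by case: (x ord0) (y ord0) => -[].
have [/flip_w //|w1] := pselect (sval (f (flip ord_max x)) w = sval (f x) w).
case: cf => f_inj _ _.
(* Two flips that both change exactly w yield the same 0-cube, against injectivity. *)
suff /f_inj e : f (flip ord0 x) = f (flip ord_max x).
  have /eqP := congr1 (fun z : {ffun 'I_n.+2 -> bool} => z ord0) e.
  by rewrite !flipE eqxx -val_eqE /=; case: (x ord0).
apply: zero_cube_eq => v; have [->|vw] := pselect (v = w).
  exact: orientation_two w0 w1.
by rewrite (w_edge _ w0 _ vw) (w_edge _ w1 _ vw).
Qed.

End Cubes.

(** * Translates of H-walls *)

Lemma mem_lmul (G : groupType) (g x : G) A : lmul g A x <-> A (g^-1 * x).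
Proof.
split=> [[a Aa <-]|Ax]; first by rewrite mulKg.
by exists (g^-1 * x); rewrite ?mulVKg.
Qed.

Lemma frontier_lmul (G : groupType) (S : seq G) g A x :
  frontier S (lmul g A) x -> frontier S A (g^-1 * x).
Proof.
move=> [/mem_lmul Ax [y Ay xy]]; split=> //; exists (g^-1 * y).
  by move=> /mem_lmul.
by rewrite cayley_adj_mul.
Qed.

(** * Quasiconvexity of the sides of an H-wall *)

Section SideStabilizer.
Variables (G : groupType) (S : seq G) (H U V : set G).
Hypotheses (subH : is_subgroup H) (wallUV : is_Hwall S H U V).

Lemma Hwall_swap h : H h -> ~ side_stabilizer H U V h ->
  lmul h U = V /\ lmul h V = U.
Proof.
move=> Hh hN; case: wallUV => _ /(_ h Hh) e _ _ _.
by case: (set2_eq e) => // -[hU hV]; case: hN.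
Qed.

(** The index is at most 2: elements t and h of H outside the stabilizer both swap U and V, so h
    t^-1 is inside. *)
Lemma side_stabilizer_dense (genS : generates S) :
  exists t, forall h, H h -> near genS t (side_stabilizer H U V) h.
Proof.
have [_ HM HV] := subH.
have [[t [Ht tN]]|all_in] := pselect (exists t, H t /\ ~ side_stabilizer H U V t).
  exists (dist genS 1 t^-1) => h Hh.
  have [hin|hN] := pselect (side_stabilizer H U V h).
    by exists h; rewrite ?distxx.
  have [[tU tV] [hU hV]] := (Hwall_swap Ht tN, Hwall_swap Hh hN).
  exists (h * t^-1); last by rewrite -{1}[h]mulg1 dist_mul.
  split; [exact/HM/HV|rewrite -{1}tV|rewrite -{1}tU];
    by rewrite lmulA mulgVK.
exists 0%N => h Hh; exists h; rewrite ?distxx //.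
by apply: contrapT => hN; apply: all_in; exists h.
Qed.

Lemma qconvex_Hwall (genS : generates S) d : slim genS d -> quasiconvex S H ->
  exists r, qconvex genS r U /\ qconvex genS r V.
Proof.
move=> slimd /(quasiconvexP genS)[r qH]; have [t Ht] := side_stabilizer_dense genS.
have qHUV : qconvex genS (r + t) (side_stabilizer H U V).
  by apply: qconvex_dense qH => // h [].
have side A : finite_union_of_orbits (side_stabilizer H U V) (frontier S A) ->
    exists n, qconvex genS n A.
  move=> [F /(finite_nat_bounded (dist genS 1))[m Fm] frA].
  by eexists; exact: qconvex_frontier slimd _ _ _ _ _ qHUV frA Fm.
case: wallUV => _ _ _ /side[m qU] /side[n qV]; exists (m + n)%N.
by split; [apply: qconvex_le qU|apply: qconvex_le qV]; rewrite ?leq_addr ?leq_addl.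
Qed.

End SideStabilizer.

(** * The wallspace conditions for the translates *)

Section Translates.
Variables (G : groupType) (S : seq G) (genS : generates S) (k : nat).
Variables (H U V : 'I_k -> set G).
Hypothesis subH : forall i, is_subgroup (H i).
Hypothesis wallUV : forall i, is_Hwall S (H i) (U i) (V i).

Local Notation W := (wall (translates U V)).
Local Notation near := (near genS).
Local Notation qconvex := (qconvex genS).

Definition translate i g : W := exist _ (i, translate_sides U V i g) (ex_intro _ g erefl).

Lemma translateP (w : W) : exists i g, w = translate i g.
Proof.
case: w => -[i P] [g /= Pg]; exists i, g.
by apply: eq_sig_hprop => [?|/=]; [exact: Prop_irrelevance|rewrite Pg].
Qed.

Lemma translate_mulH i g h : H i h -> translate i (g * h) = translate i g.
Proof.
move=> Hh; apply: eq_sig_hprop => [?|/=]; first exact: Prop_irrelevance.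
have [_ /(_ h Hh) e _ _ _] := wallUV i; congr pair.
(* The tags differ only if [U i = V i], and then h fixes the common side; otherwise both are
   [false], and a swap leaves the unordered pair unchanged. *)
rewrite /translate_sides -!lmulA; case: asboolP => UV.
  by have [[-> ->]|[-> ->]] := set2_eq e; rewrite UV.
by have [[-> ->]|[-> ->]] := set2_eq e; last rewrite setUC.
Qed.

Lemma translates_sides (w : W) : exists h h',
  [/\ h <> h', sides w = [set h; h'] & h.2 `|` h'.2 = setT].
Proof.
have [i [g ->]] := translateP w.
exists (false, lmul g (U i)), (`[< U i = V i >], lmul g (V i)); split=> //.
  case: asboolP => // UV [] /(congr1 (lmul g^-1)).
  by rewrite !lmulA mulVg !lmul1.
apply/seteqP; split=> // x _ /=; have [UV _ _ _ _] := wallUV i.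
have : (U i `|` V i) (g^-1 * x) by rewrite UV.
by case=> ?; [left|right]; apply/mem_lmul.
Qed.

Lemma translates_two_sided (w : W) : exists h h', h <> h' /\ sides w = [set h; h'].
Proof. by have [h [h' [? ? _]]] := translates_sides w; exists h, h'. Qed.

(** If g^-1 x = h f, then g h = x f^-1, and the factor h in H does not change the wall. *)
Lemma finite_translates_orbits i (L E : set G) x : (forall h, L h -> H i h) ->
  finite_union_of_orbits L E ->
  finite_set [set w | exists2 g, w = translate i g & E (g^-1 * x)].
Proof.
move=> LH [F Ffin ->].
apply: (@sub_finite_set _ _ [set translate i (x * f^-1) | f in F]); last first.
  exact: finite_image.
move=> w [g ->{w} [h /LH Hh [f Ff hf]]]; exists f => //.
have -> : x * f^-1 = g * h by rewrite -[x](mulVKg g) -hf mulgA mulgK.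
exact: translate_mulH.
Qed.

Lemma finite_translates (P : 'I_k -> set W) :
  (forall i, finite_set (P i)) -> finite_set [set w | exists i, P i w].
Proof.
move=> Pfin; apply: (@sub_finite_set _ _ (\bigcup_(i in [set: 'I_k]) P i)).
  by move=> w [i Piw]; exists i.
by apply: bigcup_finite => // i _; exact: Pfin.
Qed.

Lemma finite_betwixts x : finite_set [set w : W | betwixts w x].
Proof.
apply: (@sub_finite_set _ _ [set w | exists i,
  [set w | exists2 g, w = translate i g & (U i `&` V i) (g^-1 * x)] w]).
  move=> w; have [i [g ->{w}]] := translateP w => wx; exists i, g => //.
  split; apply/mem_lmul.
    by apply: (wx (false, lmul g (U i))); left.
  by apply: (wx (`[< U i = V i >], lmul g (V i))); right.
apply: finite_translates => i; have [_ _ UV _ _] := wallUV i.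
exact: finite_translates_orbits UV.
Qed.

(* A wall separating x and y crosses an edge of a geodesic from x to y. *)
Lemma finite_separates x y : finite_set [set w : W | separates w x y].
Proof.
pose through (A : 'I_k -> set G) z i :=
  [set w | exists2 g, w = translate i g & frontier S (A i) (g^-1 * z)].
have through_fin z i : finite_set (through U z i `|` through V z i).
  have [_ _ _ fU fV] := wallUV i; rewrite finite_setU.
  by split; [apply: finite_translates_orbits fU|apply: finite_translates_orbits fV] => h [].
apply: (@sub_finite_set _ _
  (\bigcup_(z in [set z | (dist genS x z <= dist genS x y)%N])
     [set w | exists i, (through U z i `|` through V z i) w])); last first.
  by apply: bigcup_finite => [|z _]; [exact: finite_ball|exact: finite_translates].
move=> w [h [h' [wE [[hx h'x] [h'y hy]]]]].
have [z frz xzy] := frontier_between genS hx hy.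
exists z; first by move: xzy; rewrite /= /between; lia.
have [i [g wg]] := translateP w; exists i.
have : sides w h by rewrite wE; left.
rewrite wg => -[hE|hE]; [left|right]; exists g => //; apply: frontier_lmul;
  by move: frz; rewrite hE.
Qed.

Lemma translates_wallspace :
  no_repeated_partition (translates U V) -> is_wallspace (translates U V).
Proof.
move=> part; split=> //; first by exists 1.
- exact: translates_sides.
- exact: finite_separates.
- exact: finite_betwixts.
Qed.

(** * Cocompactness *)

Section Slim.
Variable d : nat.
Hypothesis slimd : slim genS d.
Hypothesis qcH : forall i, quasiconvex S (H i).

(** Left translation is an isometry, and there are finitely many indices i. *)
Lemma qconvex_translates : exists r, forall (w : W) h, sides w h -> qconvex r h.2.
Proof.
have /choice[r qr] i : exists r, qconvex r (U i) /\ qconvex r (V i).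
  exact (qconvex_Hwall (subH i) (wallUV i) slimd (qcH i)).
exists (\max_i r i)%N => w h; have [i [g ->]] := translateP w.
have [qU qV] := qr i; have ri : (r i <= \max_i r i)%N by exact: leq_bigmax.
by case=> ->; apply: qconvex_mul; [apply: qconvex_le qU|apply: qconvex_le qV].
Qed.

Definition near_zero_cube n p (c : zero_cube (translates U V)) :=
  forall w, near n (sval c w).1.2 p.

Lemma near_zero_cube_act n g p c :
  near_zero_cube n p c -> near_zero_cube n (g * p) (cube_act g c).
Proof. by move=> cp w; apply: near_mul; exact: cp. Qed.

Lemma zero_cube_side (c : zero_cube (translates U V)) w : sides w (sval c w).1.
Proof. by case: (svalP c) => <- _ _; left. Qed.

(* A wall having a halfspace that misses the ball is oriented towards the
   ball, and only finitely many walls have both halfspaces meeting it. *)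
Lemma finite_near_zero_cube n : finite_set [set c | near_zero_cube n 1 c].
Proof.
pose ball : set G := [set x | (dist genS 1 x <= n)%N].
have ball_fin : finite_set ball by exact: finite_ball.
pose M : set W := [set w | forall h, sides w h -> near n h.2 1].
have M_fin : finite_set M.
  apply: (@sub_finite_set _ _ ((\bigcup_(x in ball) \bigcup_(y in ball)
     [set w | separates w x y]) `|` \bigcup_(x in ball) [set w | betwixts w x])).
    move=> w Mw; have [h [h' [_ wE hh']]] := translates_sides w.
    have [|x hx x_ball] := Mw h; first by rewrite wE; left.
    have [|y h'y y_ball] := Mw h'; first by rewrite wE; right.
    have bet z : h.2 z -> h'.2 z -> betwixts w z by move=> ? ? ?; rewrite wE => -[->|->].
    have [h'x|h'x] := pselect (h'.2 x); first by right; exists x => //; exact: bet.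
    have [hy|hy] := pselect (h.2 y); first by right; exists y => //; exact: bet.
    by left; exists x => //; exists y => //; exists h, h'.
  rewrite finite_setU; split.
    by do 2![apply: bigcup_finite => // ? _]; exact: finite_separates.
  by apply: bigcup_finite => // ? _; exact: finite_betwixts.
(* With a reference side for each wall, a 0-cube is encoded by the walls of M whose left side is the
   reference one. *)
have /choice[s s_side] (w : W) : exists h, sides w h.
  by have [h [h' [_ -> _]]] := translates_sides w; exists h; left.
apply: (finite_inj (f := fun c : zero_cube (translates U V) =>
  [set w | M w /\ (sval c w).1 = s w]) (finite_subsets M_fin)).
  by move=> c _ w [].
move=> c c' /= cn c'n cc'; apply: zero_cube_eq => w.
(* Where c and c' differ, their left sides are the two sides of w, both near 1; so w is in M and the
   codes differ. *)
apply: contrapT => cc'w; have wE := orientation_sides translates_two_sided cc'w.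
have Mw : M w by move=> h; rewrite wE => -[->|->].
have := s_side w; rewrite wE => -[sw|sw].
  have : [set w | M w /\ (sval c w).1 = s w] w by [].
  rewrite cc' => -[_ e]; apply: cc'w; apply: (orientation_eq translates_two_sided).
  by rewrite e sw.
have : [set w | M w /\ (sval c' w).1 = s w] w by [].
rewrite -cc' => -[_ e]; apply: cc'w; apply: (orientation_eq translates_two_sided).
by rewrite e sw.
Qed.


(** The sides cover G, so a geodesic leaving one steps into the other. This handles a wall that two
    vertices of a cube orient oppositely. *)
Lemma sides_near1 (w : W) h h' : sides w = [set h; h'] -> h.2 !=set0 ->
  h'.2 !=set0 -> exists2 a, h.2 a & near 1 h'.2 a.
Proof.
move=> wE [a ha] [b h'b]; have [h1 [h1' [_ wE1 h1U]]] := translates_sides w.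
have hh'U : h.2 `|` h'.2 = setT.
  by case: (set2_eq (etrans (esym wE) wE1)) => -[-> ->] //; rewrite setUC.
have [hb|hb] := pselect (h.2 b); first by exists b => //; exists b; rewrite ?distxx.
have [z [hz [y hy zy]] _] := frontier_between genS ha hb.
exists z => //; exists y; last exact: dist_adj.
by have [] : (h.2 `|` h'.2) y by rewrite hh'U.
Qed.

(** Finitely many left halfspaces miss 1, and each is nonempty because it meets itself. *)
Lemma zero_cube_near1 (c : zero_cube (translates U V)) :
  exists n, forall w, near n (sval c w).1.2 1.
Proof.
case: (svalP c) => _ c_meet /(_ 1) c_fin.
have /choice[a ca] w : exists a, (sval c w).1.2 a.
  by have [a []] := c_meet w w; exists a.
have [n cn] := finite_nat_bounded (fun w => dist genS 1 (a w)) c_fin; exists n => w.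
have [c1|c1] := pselect ((sval c w).1.2 1); first by exists 1; rewrite ?distxx.
by exists (a w); [|exact: cn].
Qed.

(** The Helly constant involves d and r only, so it serves all cubes, while the initial bound N at
    the base point 1 varies with the cube. *)
Lemma cube_near : exists n, forall Q : set (zero_cube (translates U V)), cube Q ->
  exists p, forall c, Q c -> near_zero_cube n p c.
Proof.
have [r qr] := qconvex_translates; exists (8 * d + 2 * r + 2)%N => Q [m [f [cf ->]]].
pose F := [set A | exists x w, A = (sval (f x) w).1.2].
have /choice[b near_b] x := zero_cube_near1 (f x).
suff [p near_p] : exists p, forall A, F A -> near (8 * d + 2 * r + 2) A p.
  by exists p => _ [x _ <-] w; apply: near_p; exists x, w.
apply: (coarse_helly slimd (N := \max_x b x) (x0 := 1)).
- by move=> _ [x [w ->]]; apply: (qr w); exact: zero_cube_side.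
- by move=> _ [x [w ->]]; apply: near_le (near_b x w); exact: leq_bigmax.
move=> _ _ [x [w ->]] [y [w' ->]].
have nonempty z v : (sval (f z) v).1.2 !=set0.
  by case: (svalP (f z)) => _ /(_ v v)[a [? _]] _; exists a.
(* Halfspaces of distinct walls are chosen together at one vertex; those of a single wall coincide
   or are its two sides. *)
have [<-|ww'] := pselect (w = w'); last first.
  have [z [zw zw']] := cube_mix translates_two_sided cf x y ww'.
  have [_ /(_ w w')[a [wa w'a]] _] := svalP (f z); rewrite zw in wa; rewrite zw' in w'a.
  by exists a => //; exists a; rewrite ?distxx.
have [xy|xy] := pselect (sval (f x) w = sval (f y) w).
  by have [a wa] := nonempty x w; exists a => //; exists a; rewrite -?xy ?distxx.
exact: sides_near1 (orientation_sides translates_two_sided xy) (nonempty x w) (nonempty y w).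
Qed.

Lemma cube_act_inj g : injective (@cube_act G k U V g).
Proof.
by move=> c c' /(congr1 (cube_act g^-1)); rewrite !cube_actA mulVg !cube_act1.
Qed.

Lemma is_cube_act g n (f : {ffun 'I_n -> bool} -> zero_cube (translates U V)) :
  is_cube f -> is_cube (fun x => cube_act g (f x)).
Proof.
elim: n f => [//|n IHn] f [f_inj f_edge f_facet]; split.
- by move=> x y /cube_act_inj/f_inj.
- by move=> n0; apply: adjacent_act; exact: f_edge.
- by move=> i b; exact: (IHn _ (f_facet i b)).
Qed.

Lemma translates_cocompact : acts_cocompactly (@cube_act G k U V).
Proof.
have [n near_n] := cube_near.
pose Z := [set c : zero_cube (translates U V) | near_zero_cube n 1 c].
(* Finitely many cubes have all vertices in the finite set Z, and p^-1 brings Q to one of them. *)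
exists [set P | cube P /\ P `<=` Z]; split=> [|P []//|Q cQ].
  apply: sub_finite_set (finite_subsets (finite_near_zero_cube n)).
  by move=> P [].
have [p near_p] := near_n Q cQ; exists p, (cube_act p^-1 @` Q).
  split; last first.
    by move=> _ [c /near_p/(near_zero_cube_act p^-1) + <-]; rewrite mulVg.
  case: cQ => m [f [cf ->]]; exists m, (fun x => cube_act p^-1 (f x)).
  by split; [exact: is_cube_act|rewrite image_comp].
rewrite image_comp [X in X @` _](_ : _ = id) ?image_id //.
by apply/funext => c /=; rewrite cube_actA mulgV cube_act1.
Qed.

(** * Properness *)

Lemma cube_act_exp g c n : @cube_act G k U V g c = c -> cube_act (g ^+ n) c = c.
Proof.
move=> gc; elim: n => [|n IHn]; first by rewrite expg0 cube_act1.
by rewrite expgS -cube_actA IHn.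
Qed.

(* If g fixes c, then c orients g^m w by the translate g^m h, which misses 1
   for large m, so these translates take finitely many values. *)
Lemma stabilizer_cut_half g c (w : W) h h' n0 : @cube_act G k U V g c = c ->
  (forall n, (n0 < n)%N -> open_sides h h' (g ^+ n) (g ^- n)) ->
  (sval c w).1 <> h.
Proof.
move=> gc cut cwh; have [_ _ /(_ 1) c_fin] := svalP c.
have cgn n : (sval c (wall_act (g ^+ n) w)).1.2 = lmul (g ^+ n) h.2.
  rewrite -{1}(cube_act_exp n gc) /= /orient_act wall_actA mulVg wall_act1 /=.
  by rewrite cwh.
have [m Am] := finite_pigeonhole (finite_image (fun w => (sval c w).1.2) c_fin).
have [i [j [/andP[ij _] eij]]] : exists i j, (i < j <= m)%N /\
    lmul (g ^+ (n0.+1 + i)) h.2 = lmul (g ^+ (n0.+1 + j)) h.2.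
  apply: Am => i _; exists (wall_act (g ^+ (n0.+1 + i)) w); last exact: cgn.
  rewrite /= cgn => /mem_lmul; rewrite mulg1.
  by have [] := cut (n0.+1 + i)%N ltac:(lia) => _ [_].
pose q := (j - i)%N; have hq : lmul (g ^+ q) h.2 = h.2.
  have := congr1 (lmul (g ^- (n0.+1 + i))) eij.
  rewrite !lmulA mulVg lmul1 => {2}->; congr lmul.
  by rewrite (_ : n0.+1 + j = (n0.+1 + i) + q)%N ?expgnDr ?mulKg // /q; lia.
have hqn t : lmul (g ^+ (t * q)) h.2 = h.2.
  by elim: t => [|t IHt]; rewrite ?lmul1 // mulSn expgnDr -lmulA IHt.
(* The exponent exceeds n0 and is a multiple of q, so this power s of g preserves h. By the cut h
   contains s, hence 1, hence s^-1, which the cut forbids. *)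
have [[hx _] [_ hNx]] := cut (n0.+1 * q)%N ltac:(rewrite /q; nia).
have h1 : h.2 1 by move: hx; rewrite -{1}(hqn n0.+1) => /mem_lmul; rewrite mulVg.
by apply: hNx; move: h1; rewrite -{1}(hqn n0.+1) => /mem_lmul; rewrite mulg1.
Qed.

Hypothesis cutUV : forall g : G, infinite_order g ->
  exists w : wall (translates U V), cuts_axis w g.

Lemma stabilizer_torsion g c :
  @cube_act G k U V g c = c -> infinite_order g -> False.
Proof.
move=> gc /cutUV[w [h [h' [wE [n0 cut]]]]].
have := zero_cube_side c w; rewrite wE => -[|] cw.
  exact: stabilizer_cut_half gc cut cw.
(* If c chooses h', pass to g^-1, which exchanges the ends of the axis. *)
apply: (@stabilizer_cut_half g^-1 c w h' h n0) cw.
  by rewrite -{1}gc cube_actA mulVg cube_act1.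
by move=> n /cut[? ?]; split; rewrite expVgn ?invgK.
Qed.

Lemma infinite_orderP g u : (forall n, dist genS 1 (u ^+ n) = (n * dist genS 1 u)%N) ->
  (0 < dist genS 1 u)%N -> infinite_order (u ^ g).
Proof.
move=> du u_gt0 n n_gt0; rewrite -conjXg => /eqP; rewrite conjg_eq1 => /eqP un.
by have := du n; rewrite un distxx; lia.
Qed.

(* The vertices v_i of a long geodesic from p to kp, with k fixing c, have only
   finitely many v_i^-1 c and cone types, and a repetition yields an element of
   infinite order fixing c. *)
Lemma translates_proper : acts_properly (@cube_act G k U V).
Proof.
move=> c; have [r qr] := qconvex_translates; have [n near_n] := cube_near.
have [|p near_p] := near_n [set c].
  exists 0%N, (fun=> c); split=> //; apply/seteqP; split=> [_ ->|_ [_ _ <-] //].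
  by exists [ffun=> false].
have {near_p} near_c : near_zero_cube n p c by exact: near_p.
(* m is the constant of [qconvex_near], and N the radius at which types determine cones. *)
pose m := (d + d + n + r)%N; pose N := (d + d + 2)%N.
have Z_fin : finite_set ([set c | near_zero_cube m 1 c] `*`
    [set B : set G | B `<=` [set x | (dist genS 1 x <= N)%N]]).
  apply: finite_setX; first exact: finite_near_zero_cube.
  exact/finite_subsets/finite_ball.
have [M pigeon] := finite_pigeonhole Z_fin.
(* It suffices to bound how far the stabilizer moves p, since g p determines g and balls are
   finite. *)
apply: (@finite_inj _ _ _ _ (fun g => g * p) (finite_ball genS M p)); last first.
  by move=> g g' _ _ /mulIg.
move=> g gc /=; rewrite leqNgt; apply/negP => g_far.
have [v [v0 vn dv]] := geodesic_points genS p (g * p).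
have vi_between i : (i <= M)%N -> between genS p (v i) (g * p).
  move=> iM; have := dv 0%N i; have := dv i (dist genS p (g * p)).
  by rewrite /between v0 vn => -> => [->|]; lia.
pose f i := (cube_act (v i)^-1 c, cone_type genS N (p^-1 * v i)).
have [|i [j [/andP[ij jM] fij]]] := pigeon f.
  move=> i /vi_between pvg; split=> [|x [] //] w /=.
  rewrite -(mulVg (v i)); apply: near_zero_cube_act => {}w.
  (* Since g fixes c, both p and g p are near every left halfspace of c, hence so are the points
     between them. *)
  apply: (qconvex_near slimd (qr w _ (zero_cube_side c w)) (near_c w) _ pvg).
  by have := near_zero_cube_act g near_c; rewrite gc; exact.
pose u := (v i)^-1 * v j.
have gu : p^-1 * v i * u = p^-1 * v j by rewrite /u -mulgA mulVKg.
have du : dist genS 1 u = (j - i)%N.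
  by rewrite -(dist_mul genS (v i)) mulg1 mulVKg dv; lia.
have u_iter t : dist genS 1 (u ^+ t) = (t * dist genS 1 u)%N.
  apply: (cone_type_iter slimd (g := p^-1 * v i)); first by rewrite gu -[LHS]/(f i).2 fij.
  rewrite gu; apply/(between_mul genS p); rewrite mulg1 !mulVKg.
  by rewrite /between -v0 !dv; lia.
apply: (@stabilizer_torsion (u ^ (v i)^-1) c); last first.
  by apply: infinite_orderP => //; lia.
have -> : u ^ (v i)^-1 = v j * (v i)^-1 by rewrite conjgE invgK /u !mulgA mulgV mul1g.
by rewrite -cube_actA -[cube_act _ c]/(f i).1 fij cube_actA mulgV cube_act1.
Qed.

End Slim.
End Translates.

Theorem theorem1p5 (G : groupType) (S : seq G) (hG : word_hyperbolic S)
    (k : nat) (H U V : 'I_k -> set G)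
    (hsub : forall i, is_subgroup (H i))
    (hqc : forall i, quasiconvex S (H i))
    (hwall : forall i, is_Hwall S (H i) (U i) (V i))
    (hpart : no_repeated_partition (translates U V))
    (hcut : forall g : G, infinite_order g ->
       exists w : wall (translates U V), cuts_axis w g) :
  is_wallspace (translates U V) /\
  acts_properly (@cube_act G k U V) /\
  acts_cocompactly (@cube_act G k U V).
Proof.
have [genS /(hyperbolic_slim genS)[d slimd]] := hG.
split; first exact (translates_wallspace genS hwall hpart).
split; first exact (translates_proper hsub hwall slimd hqc hcut).
exact (translates_cocompact hsub hwall slimd hqc).
Qed.
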